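(* For every integer $\ell \ge 2$, there exists a finite connected vertex-transitive $3$-valent flexible graph $\Gamma_\ell$ whose girth is $2\ell$.
   Context: Graphs are simple and undirected. A graph is $3$-valent if every vertex has exactly three neighbours, and vertex-transitive if its automorphism group acts transitively on its vertices. The girth of a graph is the length of its shortest cycle. A connected vertex-transitive $3$-valent graph $\Gamma$ is called flexible if $\mathrm{Aut}(\Gamma)$ has exactly two orbits on the edge set of $\Gamma$ and the stabiliser in $\mathrm{Aut}(\Gamma)$ of every vertex has order at least $4$. *)

(* Defs.v *)
From HB Require Import structures.
From mathcomp Require Import all_boot all_fingroup.

Set Implicit Arguments.
Unset Strict Implicit.
Unset Printing Implicit Defensive.

Record sgraph := SGraph {
  vertex :> finType;
  adj : rel vertex;
  adj_sym : symmetric adj;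
  adj_irrefl : irreflexive adj }.

Definition edges (G : sgraph) : {set {set G}} :=
  [set [set p.1; p.2] | p : G * G & adj p.1 p.2].

Definition autg (G : sgraph) : {set {perm G}} :=
  [set s : {perm G} | [forall x, forall y, adj (s x) (s y) == adj x y]].

Lemma autg_group_set (G : sgraph) : group_set (autg G).
Proof.
apply/group_setP; split=> [|s t].
  by rewrite inE; apply/forallP=> x; apply/forallP=> y; rewrite !perm1.
rewrite !inE => /forallP Hs /forallP Ht.
apply/forallP=> x; apply/forallP=> y; rewrite !permM.
by rewrite (eqP (forallP (Ht _) _)) (eqP (forallP (Hs _) _)).
Qed.

Canonical autg_group (G : sgraph) := Group (autg_group_set G).

Definition trivalent (G : sgraph) : Prop :=
  forall x : G, #|[set y | adj x y]| = 3.

Definition connected (G : sgraph) : Prop :=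
  0 < #|G| /\ forall x y : G, connect (@adj G) x y.

Definition vertex_transitive (G : sgraph) : Prop :=
  [transitive autg G, on [set: G] | 'P].

Definition edge_orbits (G : sgraph) : {set {set {set G}}} :=
  [set orbit ('P^*)%act (autg G) e | e in edges G].

Definition flexible (G : sgraph) : Prop :=
  [/\ connected G, vertex_transitive G, trivalent G,
      #|edge_orbits G| = 2
    & forall x : G, 4 <= #|('C_(autg G)[x | 'P])%g| ].

(* The bound 3 <= size c discards the closed walks [::] and [:: x; y], which
   also satisfy ucycle for a symmetric relation. *)
Definition is_cycle (G : sgraph) (c : seq G) : Prop :=
  ucycle (@adj G) c /\ 3 <= size c.

Definition has_girth (G : sgraph) (g : nat) : Prop :=
  (exists2 c : seq G, is_cycle c & size c = g) /\
  (forall c : seq G, is_cycle c -> g <= size c).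

(* Main.v *)
Require Import Defs.
From HB Require Import structures.
From mathcomp Require Import all_boot all_fingroup all_algebra.

Set Implicit Arguments.
Unset Strict Implicit.
Unset Printing Implicit Defensive.

Import GRing.Theory.

(** Put m = 2 * l.  The Cartesian product of two m-cycles is 4-valent and is the
    union of m rows and m columns, each of them an m-cycle.  Splitting every
    grid point into a row copy and a column copy, joined by an edge, gives a
    cubic graph: the m-cycles form a 2-factor and the joining edges a perfect
    matching.  The dihedral symmetries of the two coordinates and the exchange
    of rows and columns act on it; they are transitive on vertices, preserve the
    2-factor, and reflecting neither, one or both coordinates about a vertex
    gives four symmetries that fix it.  But the cycles around a small rectangle
    of the grid use the matching and have bounded length, so the girth is too
    small for large m.

    The remedy is a voltage cover.  Let K be a finite group with an involution
    [toggle p] for every grid point p, such that no nonempty product of at most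
    m of these, in which consecutive factors differ, is trivial
    ([prod_toggle_neq1]).  The cover has vertices (vertex of the split torus,
    element of K); a 2-factor edge keeps the element of K and the matching edge
    at p multiplies it by [toggle p].  The 2-factor still consists of m-cycles.
    A cycle that uses the matching reads off, from its matching edges, a trivial
    product in K; consecutive factors differ, as the cycle would otherwise come
    back to the vertex where it last entered a circle.  So it has more than m
    matching edges ([crossing_cycle_long]), and the girth is exactly m.

    The group K is the group of all permutations of a set on which permutations
    of the grid points act too, by [relabel], which conjugates [toggle p] to
    [toggle (f p)].  Hence every symmetry of the split torus lifts, by
    multiplying the K-coordinate by [relabel] on the right, and left
    translations of K are symmetries as well ([symmetry_adj]).  So the cover is
    vertex-transitive, and the lifted reflections still fix a vertex and are
    still distinct.

    The cover need not be connected, so the graph is one of its components.  Its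
    edges fall into at most two orbits, because a reflection exchanges the two
    2-factor edges at a vertex.  They fall into exactly two, because 2-factor
    edges lie on m-cycles and matching edges do not
    ([edge_orbits_not_merged]). *)

(** * Involutions without short reduced relations *)

Section Toggles.

Variables (M : finType) (N : nat).

(** A tape is a cyclic word [w], with blank letters allowed, together with a
    position on it.  Letter [w i] is thought of as labelling the edge from
    position [i] to position [i + 1]. *)
Definition tape := ({ffun 'I_N.+2 -> option M} * 'I_N.+2)%type.

(** The involution of the letter [e] moves the position along the edges labelled
    [e].  To have these edges pairwise disjoint, an edge is only used if the edge
    just before it has a different label. *)
Definition toggle_fun (e : M) (t : tape) : tape :=
  let: (w, i) := t in
  if (w i == Some e) && (w (i - 1)%R != Some e) then (w, (i + 1)%R)
  else if (w (i - 1)%R == Some e) && (w (i - 1 - 1)%R != Some e)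
  then (w, (i - 1)%R) else (w, i).

Lemma toggle_funK e : involutive (toggle_fun e).
Proof.
case=> w i; rewrite /toggle_fun.
case: ifPn => [/andP[wi wi1]|up].
  by rewrite addrK wi wi1 /= andbF.
case: ifPn => [/andP[wi wi1]|down]; first by rewrite wi wi1 subrK.
by rewrite (negPf up) (negPf down).
Qed.

Definition toggle e : {perm tape} := perm (can_inj (toggle_funK e)).

Lemma toggleK e : (toggle e * toggle e = 1)%g.
Proof. by apply/permP => t; rewrite permM !permE toggle_funK. Qed.

Definition relabel_fun (f : M -> M) (t : tape) : tape :=
  ([ffun j => omap f (t.1 j)], t.2).

Lemma relabel_fun_inj f : injective f -> injective (relabel_fun f).
Proof.
move=> f_inj [w i] [w' i'] [/ffunP eq_w ->]; congr (_, _).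
apply/ffunP => j; move: (eq_w j); rewrite !ffunE.
by case: (w j) (w' j) => [a|] [b|] //= [/f_inj ->].
Qed.

Definition relabel f (f_inj : injective f) : {perm tape} :=
  perm (relabel_fun_inj f_inj).

Lemma toggle_relabel f (f_inj : injective f) e :
  (toggle e * relabel f_inj = relabel f_inj * toggle (f e))%g.
Proof.
have fE o : (omap f o == Some (f e)) = (o == Some e).
  by case: o => [a|] //=; rewrite !(inj_eq Some_inj) (inj_eq f_inj).
apply/permP => -[w i]; rewrite !permM !permE /= /relabel_fun /= !ffunE !fE.
by case: ifP => // _; case: ifP.
Qed.

Definition reduced (s : seq M) := sorted (fun a b => a != b) s.

(** Write [s] on a blank tape.  Reducedness keeps all its edges in use, so the
    product of the toggles of [s] moves position [0] step by step to position
    [size s], which is not [0] as long as the tape is longer than [s].  At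
    position [0] the preceding edge is the last of the cycle, which is blank. *)
Lemma prod_toggle_neq1 s :
  reduced s -> 0 < size s <= N.+1 -> (\prod_(e <- s) toggle e)%g != 1%g.
Proof.
move=> red_s /andP[s_gt0 s_le].
have [e0 _] : exists e0, e0 \in s.
  by case: s s_gt0 {red_s s_le} => // e0 s' _; exists e0; apply: mem_head.
pose w : {ffun 'I_N.+2 -> option M} := [ffun i => onth s (val i)].
have walk k : k <= size s ->
    (\prod_(e <- take k s) toggle e)%g (w, 0%R) = (w, k%:R%R).
  elim: k => [|k IHk] lt_k; first by rewrite take0 big_nil perm1.
  have ltkN : k < N.+2 by apply: leq_trans lt_k (leqW s_le).
  have wE j : j < size s -> w j%:R%R = Some (nth e0 s j).
    move=> lt_j; rewrite ffunE Zp_nat /= modn_small ?onthE ?(nth_map e0) //.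
    by apply: leq_trans lt_j (leqW s_le).
  (* The edge behind the current position does not bear the next letter. *)
  have fresh : w (k%:R - 1)%R != Some (nth e0 s k).
    case: k {IHk ltkN} => [|k] in lt_k *.
      rewrite mulr0n add0r ffunE.
      have -> : val (- 1 : 'I_N.+2)%R = N.+1 by rewrite /= !modn_small ?subn1.
      by rewrite onth_default.
    rewrite -natr1 addrK wE ?(ltnW lt_k) // (inj_eq Some_inj).
    by move/(sortedP e0): red_s => /(_ k lt_k).
  rewrite (take_nth e0) // -cats1 big_cat big_seq1 permM /= IHk ?(ltnW lt_k) //.
  by rewrite permE /= wE // eqxx fresh natr1.
apply/eqP => /permP /(_ (w, 0%R)); rewrite perm1 -[s in LHS]take_size walk //.
move=> [] /(congr1 val); rewrite Zp_nat /= modn_small ?ltnS //.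
by move=> s0; rewrite s0 in s_gt0.
Qed.

End Toggles.

(** * The component of a vertex *)

Section Component.

Variables (G : sgraph) (x0 : G).

Definition component_vertex := {y : G | connect (@adj G) x0 y}.
Definition component_adj : rel component_vertex := relpre val (@adj G).

Lemma component_adj_sym : symmetric component_adj.
Proof. by move=> x y; apply: adj_sym. Qed.

Lemma component_adj_irrefl : irreflexive component_adj.
Proof. by move=> x; apply: adj_irrefl. Qed.

Definition component := SGraph component_adj_sym component_adj_irrefl.

Definition component_root : component := Sub x0 (connect0 (@adj G) x0).

Lemma component_connected : connected component.
Proof.
split=> [|x y]; first by apply/card_gt0P; exists component_root.
have reach (z : component) : connect (@adj component) component_root z.
  case: z => z z_in; have /connectP[p x0p z_def] := z_in.
  elim/last_ind: p z x0p z_def z_in => [|p w IHp] z.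
    move=> _ /= -> x0_in; rewrite (_ : exist _ x0 x0_in = component_root) //.
    exact: val_inj.
  rewrite rcons_path last_rcons => /andP[x0p pw] -> w_in.
  have last_in : connect (@adj G) x0 (last x0 p) by apply/connectP; exists p.
  apply: connect_trans (IHp _ x0p erefl last_in) (connect1 _).
  exact: pw.
apply: connect_trans (reach y).
by rewrite (sym_connect_sym (@adj_sym component)).
Qed.

Lemma component_trivalent : trivalent G -> trivalent component.
Proof.
move=> G3 x; rewrite -(G3 (val x)) -(card_imset _ val_inj); apply: eq_card => y.
rewrite inE; apply/imsetP/idP => [[z] /[!inE] xz -> // | xy].
have y_in : connect (@adj G) x0 y := connect_trans (valP x) (connect1 xy).
by exists (Sub y y_in) => //; rewrite inE.
Qed.

(** The image of the root decides whether an automorphism preserves the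
    component. *)
Lemma component_aut (f : G -> G) :
    injective f -> (forall x y, adj (f x) (f y) = adj x y) ->
    connect (@adj G) x0 (f x0) ->
  exists2 s : {perm component},
    s \in autg component & forall y, val (s y) = f (val y).
Proof.
move=> f_inj f_adj f_x0.
have f_in (y : component) : connect (@adj G) x0 (f (val y)).
  apply: connect_trans f_x0 _; have /connectP[p x0p ->] := valP y.
  apply/connectP; exists (map f p); last by rewrite last_map.
  by rewrite path_map; apply: sub_path x0p => u v /=; rewrite f_adj.
pose g (y : component) : component := Sub (f (val y)) (f_in y).
have g_inj : injective g by move=> x y [] /f_inj/val_inj.
exists (perm g_inj) => [|y]; last by rewrite permE.
rewrite inE; apply/forallP => x; apply/forallP => y; rewrite !permE.
by rewrite /= /component_adj /= f_adj.
Qed.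

Lemma component_cycle (c : seq component) : is_cycle (map val c) <-> is_cycle c.
Proof.
rewrite /is_cycle size_map /ucycle map_inj_uniq; last exact: val_inj.
by rewrite /cycle; case: c => //= x p; rewrite -map_rcons path_map.
Qed.

Lemma component_cycle_lift (p : seq G) :
    is_cycle (x0 :: p) ->
  exists2 q : seq component,
    is_cycle (component_root :: q) & map val q = p.
Proof.
move=> c_cyc; have [/andP[x0p _] _] := c_cyc.
have p_in y : y \in p -> connect (@adj G) x0 y.
  by move=> yp; apply: (path_connect x0p); rewrite inE mem_rcons inE yp !orbT.
pose q : seq component := map (insubd component_root) p.
have q_val : map val q = p.
  rewrite -map_comp map_id_in // => y /p_in y_in /=; exact: insubdK.
by exists q => //; apply/component_cycle; rewrite /= q_val.
Qed.

End Component.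

(** * The voltage cover of the split torus *)

Section SplitTorus.

Variable n : nat.

Local Notation Z := (ordinal n.+3).
Local Notation K := {perm tape (Z * Z)%type n.+2}.

(** In [(a, b, s, x)], the bit [s] tells rows from columns, [a] is the index of
    the row or column, [b] is the position on it, and [x] is the voltage.
    Storing the index first makes the moves along rows and along columns the
    same formula.  The tapes have [n.+4] positions, one more than the length
    [n.+3] of the rows and columns. *)
Definition split_vertex := (Z * Z * bool * K)%type.

Definition swap_if (s : bool) (p : Z * Z) := if s then (p.2, p.1) else p.

(** The grid point below a vertex, with its coordinates in a fixed order. *)
Definition label (u : split_vertex) : Z * Z := swap_if u.1.2 u.1.1.

(** The other copy of the same grid point; the voltage changes by its toggle. *)
Definition cross (u : split_vertex) : split_vertex :=
  let: (a, b, s, x) := u in (b, a, ~~ s, (x * toggle _ (label u))%g).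

Definition shift (d : Z) (u : split_vertex) : split_vertex :=
  let: (a, b, s, x) := u in (a, (b + d)%R, s, x).

Definition along : rel split_vertex :=
  fun u v => (v == shift 1%R u) || (v == shift (- 1)%R u).

Definition split_adj : rel split_vertex :=
  fun u v => along u v || (v == cross u).

Lemma crossK : involutive cross.
Proof.
case=> [[[a b] s] x]; rewrite /cross negbK /label /=.
by case: s; rewrite -mulgA toggleK mulg1.
Qed.

Lemma shiftK d : cancel (shift d) (shift (- d)%R).
Proof. by case=> [[[a b] s] x]; rewrite /= addrK. Qed.

Lemma along_sym : symmetric along.
Proof.
have half d u v : (v == shift d u) = (u == shift (- d)%R v).
  apply/eqP/eqP => ->; first by rewrite shiftK.
  by rewrite -{1}[d]opprK shiftK.
by move=> u v; rewrite /along (half 1%R u) (half (- 1)%R u) opprK orbC.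
Qed.

Lemma split_adj_sym : symmetric split_adj.
Proof.
move=> u v; rewrite /split_adj along_sym; congr (_ || _).
by apply/eqP/eqP => ->; rewrite crossK.
Qed.

Lemma one_neq0 : (1 : Z)%R != 0%R. Proof. by []. Qed.
Lemma one_neqN1 : (1 : Z)%R != (- 1)%R.
Proof. by rewrite -val_eqE /= !modn_small ?subn1. Qed.

Lemma shift_side d u : (shift d u).1.2 = u.1.2.
Proof. by case: u => [[[a b] s] x]. Qed.

Lemma cross_side u : (cross u).1.2 = ~~ u.1.2.
Proof. by case: u => [[[a b] s] x]. Qed.

Lemma along_side u v : along u v -> v.1.2 = u.1.2.
Proof. by case/orP => /eqP->; rewrite shift_side. Qed.

Lemma along_voltage u v : along u v -> v.2 = u.2.
Proof. by case: u => [[[a b] s] x]; case/orP => /eqP->. Qed.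

Lemma shift_eq d d' u : (shift d u == shift d' u) = (d == d').
Proof.
case: u => [[[a b] s] x]; apply/eqP/eqP => [|-> //].
by move/(congr1 (fun v => v.1.1.2)) => /=; apply: addrI.
Qed.

Lemma split_adj_irrefl : irreflexive split_adj.
Proof.
move=> u; have shift0 : shift 0%R u = u.
  by case: u => [[[a b] s] x]; rewrite /= addr0.
rewrite /split_adj /along -{1 3}shift0 !shift_eq eq_sym (negPf one_neq0).
rewrite eq_sym oppr_eq0 (negPf one_neq0) /=.
apply/eqP => /(congr1 (fun v => v.1.2)); rewrite cross_side.
by case: u.1.2.
Qed.

Definition split_torus := SGraph split_adj_sym split_adj_irrefl.

Lemma shift_adj (u : split_torus) d :
  (d == 1%R) || (d == (- 1)%R) -> adj u (shift d u).
Proof. by rewrite /= /split_adj /along !shift_eq => ->. Qed.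

Lemma cross_adj (u : split_torus) : adj u (cross u).
Proof. by rewrite /= /split_adj eqxx orbT. Qed.

Lemma split_torus_trivalent : trivalent split_torus.
Proof.
move=> u; have -> : [set v | adj u v] = [set shift 1%R u; shift (- 1)%R u; cross u].
  by apply/setP => v; rewrite !inE.
have cross_notin : (cross u : split_torus) \notin [set shift 1%R u; shift (- 1)%R u].
  by apply/set2P => -[] /(congr1 (fun v => v.1.2)); rewrite cross_side shift_side;
    case: u.1.2.
by rewrite setUC cardsU1 cards2 shift_eq one_neqN1 cross_notin.
Qed.

(** Element of the dihedral group acting on coordinate [s]: a reflection if
    [eps s] holds, then a translation by [t s]. *)
Definition dihedral (eps : bool -> bool) (t : bool -> Z) (s : bool) (b : Z) : Z :=
  ((-1) ^+ eps s * b + t s)%R.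

Lemma dihedral_inj eps t s : injective (dihedral eps t s).
Proof. by move=> b b' /addIr/(can_inj (signrMK _)). Qed.

Definition label_map (c : bool) eps t (p : Z * Z) : Z * Z :=
  swap_if c (dihedral eps t false p.1, dihedral eps t true p.2).

Lemma label_map_inj c eps t : injective (label_map c eps t).
Proof.
move=> [p q] [p' q'] /eqP; rewrite /label_map.
by case: c; rewrite xpair_eqE !(inj_eq (@dihedral_inj _ _ _)) /= => /andP[/eqP-> /eqP->].
Qed.

(** Lift of a symmetry of the grid to the cover; [c] exchanges rows and columns.
    Crossings multiply the voltage on the right, so they commute with the
    translation by [h], and [toggle_relabel] moves [relabel] past them. *)
Definition symmetry c eps t (h : K) (u : split_torus) : split_torus :=
  let: (a, b, s, x) := u in
  (dihedral eps t s a, dihedral eps t (~~ s) b, c (+) s,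
   (h * x * relabel n.+2 (@label_map_inj c eps t))%g).

Lemma symmetry_inj c eps t h : injective (symmetry c eps t h).
Proof.
move=> [[[a b] s] x] [[[a' b'] s'] x'] /= eq_im.
have /= /addbI eq_s := congr1 (fun v => v.1.2) eq_im.
rewrite {}eq_s in eq_im *.
have /= /dihedral_inj -> := congr1 (fun v => v.1.1.1) eq_im.
have /= /dihedral_inj -> := congr1 (fun v => v.1.1.2) eq_im.
by have /= /mulIg/mulgI -> := congr1 snd eq_im.
Qed.

Lemma symmetry_cross c eps t h u :
  symmetry c eps t h (cross u) = cross (symmetry c eps t h u).
Proof.
case: u => [[[a b] s] x]; rewrite /= negbK addbN; congr (_, _).
rewrite -!mulgA toggle_relabel; do 3!congr (_ * _)%g; congr (toggle _ _).
by rewrite /label /label_map; case: s c => [] [].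
Qed.

Lemma symmetry_shift c eps t h d u :
  symmetry c eps t h (shift d u)
  = shift ((-1) ^+ eps (~~ u.1.2) * d)%R (symmetry c eps t h u).
Proof.
by case: u => [[[a b] s] x]; rewrite /= /dihedral mulrDr addrAC.
Qed.

Lemma symmetry_adj c eps t h u v :
  adj (symmetry c eps t h u) (symmetry c eps t h v) = adj u v.
Proof.
rewrite /= /split_adj /along -symmetry_cross.
rewrite -!(inj_eq (@symmetry_inj c eps t h) v) !symmetry_shift.
case: (eps _); last by rewrite expr0 !mul1r.
by rewrite expr1 !mulN1r opprK; congr (_ || _); rewrite orbC.
Qed.

Definition split_root : split_torus := (0%R, 0%R, false, 1%g).

Lemma symmetry_transitive u :
  exists c eps t h, symmetry c eps t h split_root = u.
Proof.
case: u => [[[a b] s] x].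
pose t c := if c then b else a.
exists s, (fun=> false), t, (x * (relabel n.+2 (@label_map_inj s (fun=> false) t))^-1)%g.
by rewrite /symmetry /dihedral /= !mulr0 !add0r addbF mulg1 mulgKV.
Qed.

(** * Cycles of the cover *)

Lemma split_adj_along u v : split_adj u v -> v.1.2 == u.1.2 -> along u v.
Proof.
by case/orP => // /eqP->; rewrite cross_side; case: u.1.2.
Qed.

Lemma split_adj_cross u v : split_adj u v -> v.1.2 != u.1.2 -> v = cross u.
Proof. by case/orP => [/along_side -> /eqP | /eqP]. Qed.

Lemma label_cross u : label (cross u) = label u.
Proof. by case: u => [[[a b] []] x]. Qed.

Lemma eq_by_label u v :
  u.1.2 = v.1.2 -> u.2 = v.2 -> label u = label v -> u = v.
Proof.
case: u v => [[[a b] s] x] [[[a' b'] s'] x'] /= -> ->; rewrite /label /=.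
by case: s' => /= -[-> ->].
Qed.

(** The sequence of labels of the matching edges of a walk. *)
Fixpoint crossings (u : split_vertex) (p : seq split_vertex) : seq (Z * Z) :=
  if p is v :: q then
    if v.1.2 == u.1.2 then crossings v q else label u :: crossings v q
  else [::].

Lemma size_crossings u p : size (crossings u p) <= size p.
Proof.
elim: p u => //= v p IHp u; case: ifP => _; first exact: leqW (IHp v).
exact: IHp.
Qed.

Lemma path_voltage u p : path split_adj u p ->
  ((last u p).2 = u.2 * \prod_(e <- crossings u p) toggle n.+2 e)%g.
Proof.
elim: p u => [|v p IHp] u /=; first by rewrite big_nil mulg1.
case/andP => uv vp; rewrite {}IHp //; case: ifPn => side_v.
  by rewrite (along_voltage (split_adj_along uv side_v)).
rewrite big_cons mulgA (split_adj_cross uv side_v).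
by case: u {uv side_v} => [[[a b] s] x].
Qed.

(** Until its first crossing a walk stays on one circle, where the side and the
    voltage are constant. *)
Lemma crossings_head u p e w :
    path split_adj u p -> crossings u p = e :: w ->
  (exists q, p = cross u :: q) \/
  exists2 z, z \in p & [/\ z.1.2 = u.1.2, z.2 = u.2 & label z = e].
Proof.
elim: p u => //= v p IHp u /andP[uv vp]; case: ifPn => side_v.
  have uv_along := split_adj_along uv side_v.
  move=> ew; right; case: (IHp _ vp ew) => [[q p_eq]|[z zp [z_side z_volt z_lab]]].
    exists v; rewrite ?mem_head //; split; first exact/eqP.
      exact: along_voltage.
    by move: ew; rewrite p_eq /= cross_side; case: (v.1.2) => -[].
  exists z; first by rewrite inE zp orbT.
  by rewrite z_side z_volt (along_side uv_along) (along_voltage uv_along).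
by left; exists p; rewrite (split_adj_cross uv side_v).
Qed.

(** Here [v] is the vertex reached by a crossing.  If the next crossing had the
    same label, it would start at [v] again, by [eq_by_label]; without repeated
    vertices it would then be the same edge traversed backwards. *)
Lemma reduced_after_cross v p :
    path split_adj v p -> uniq (v :: p) -> (forall q, p <> cross v :: q) ->
  reduced (crossings v p) -> reduced (label v :: crossings v p).
Proof.
move=> vp /andP[v_notin _] no_return; rewrite /reduced.
case w_eq: (crossings v p) => [|e w] //= ->; rewrite andbT eq_sym.
case: (crossings_head vp w_eq) => [[q /no_return] // | [z zp [zs zv <-]]].
by apply: contraNneq v_notin => /(eq_by_label zs zv) <-.
Qed.

Lemma crossings_reduced u p :
  path split_adj u p -> uniq (u :: p) -> reduced (crossings u p).
Proof.
elim: p u => // v p IHp u /= /andP[uv vp] /andP[u_notin vp_uniq].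
have red_vp := IHp v vp vp_uniq; case: ifPn => // side_v.
have v_eq := split_adj_cross uv side_v.
rewrite -label_cross -v_eq; apply: reduced_after_cross => // q p_eq.
by move: u_notin; rewrite p_eq v_eq crossK !inE eqxx orbT.
Qed.

(** Starting at one of its crossings, a cycle reads a reduced word whose product
    is trivial, and [prod_toggle_neq1] bounds the length of this word. *)
Lemma crossing_cycle_long (u : split_torus) (p : seq split_torus) :
  is_cycle [:: u, (cross u : split_torus) & p] -> n.+3 < size (u :: cross u :: p).
Proof.
move=> [/andP[c_path c_uniq] c_size].
have c_path' : path split_adj u (cross u :: rcons p u) by [].
set v := cross u in c_path c_uniq c_size c_path' *.
have /andP[_ vp] := c_path'.
have vp_uniq : uniq (v :: rcons p u) by rewrite -rcons_cons rcons_uniq.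
have cr_eq : crossings u (v :: rcons p u) = label v :: crossings v (rcons p u).
  by rewrite /= {1 2}/v cross_side label_cross; case: u.1.2.
have cr_red : reduced (crossings u (v :: rcons p u)).
  rewrite cr_eq; apply: reduced_after_cross (crossings_reduced _ _) => // q.
  rewrite /v crossK; case: p c_size c_uniq {c_path c_path' vp vp_uniq cr_eq} => //.
  by move=> y p _ /= /[swap] -[-> _]; rewrite !inE eqxx orbT.
have := path_voltage c_path'; rewrite /= last_rcons => volt.
rewrite ltnNge; apply/negP => short.
suff /eqP : (\prod_(e <- crossings u (v :: rcons p u)) toggle n.+2 e)%g = 1%g.
  apply/negP/prod_toggle_neq1; rewrite // cr_eq /=.
  by apply: leq_trans short; rewrite -(size_rcons p u) ltnS size_crossings.
by apply: (mulgI u.2); rewrite mulg1.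
Qed.

(** The two neighbours of [u] in the cycle are distinct, so they are both
    neighbours of [u] on its circle.  Hence the cycle is closed under [shift 1]
    and covers the whole circle. *)
Lemma along_cycle_long (c : seq split_torus) :
  is_cycle c -> path.cycle along c -> n.+3 <= size c.
Proof.
move=> [/andP[_ c_uniq] c_size] c_along.
have up_in u : u \in c -> shift 1%R u \in c.
  move=> /rot_to[i q c_rot].
  have : 2 < size (u :: q) by rewrite -c_rot size_rot.
  have : path.cycle along (u :: q) by rewrite -c_rot rot_cycle.
  have : uniq (u :: q) by rewrite -c_rot rot_uniq.
  rewrite -(mem_rot i) c_rot {c_rot}; case: q => [|v [|w q]] // .
  rewrite /= rcons_path => /and3P[_ /= v_notin _] /andP[uv /andP[_ /andP[_ lu]]] _.
  rewrite along_sym in lu; case/orP: uv => [/eqP<-|/eqP v_eq].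
    by rewrite !inE eqxx orbT.
  case/orP: lu => /eqP l_eq; first by rewrite -l_eq 2!in_cons mem_last !orbT.
  by move: v_notin; rewrite v_eq -l_eq mem_last.
case: c c_uniq c_size up_in {c_along} => // u c c_uniq _ up_in.
have all_in k : shift k%:R%R u \in u :: c.
  elim: k => [|k IHk].
    by case: u {c_uniq up_in} => [[[a b] s] x]; rewrite /= addr0 mem_head.
  rewrite -natr1 (_ : shift _ u = shift 1%R (shift k%:R%R u)) ?up_in //.
  by case: u {c_uniq up_in IHk} => [[[a b] s] x]; rewrite /= addrA.
rewrite -[n.+3]card_ord -(size_image (fun d : Z => shift d u)).
apply: uniq_leq_size.
  rewrite map_inj_uniq ?enum_uniq // => d d' /eqP.
  by rewrite shift_eq => /eqP.
by move=> v /imageP[d _ ->]; rewrite -[d]natr_Zp all_in.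
Qed.

Lemma split_torus_girth (c : seq split_torus) : is_cycle c -> n.+3 <= size c.
Proof.
move=> c_cyc; have [/andP[c_adj c_uniq] c_size] := c_cyc.
have [c_along|] := boolP (all (fun u : split_torus => along u (next c u)) c).
  apply: along_cycle_long => //; apply: (@cycle_from_next split_torus) => // u.
  by move/(allP c_along).
case/allPn => u uc not_along; apply: ltnW; rewrite -(size_rot (index u c)).
have [i q c_rot] := rot_to uc.
have next_u : next c u = cross u.
  by have /orP[|/eqP//] := next_cycle c_adj uc; rewrite (negPf not_along).
have : is_cycle (u :: q).
  by rewrite /is_cycle /ucycle -c_rot rot_cycle rot_uniq size_rot c_adj.
move: next_u; rewrite size_rot -(next_rot i c_uniq) -(size_rot i c) c_rot.
case: q {c_rot} => [|v q] /=; first by move=> _ [].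
by rewrite eqxx => ->; apply: crossing_cycle_long.
Qed.

Definition circle_tail : seq split_torus :=
  [seq shift k%:R%R split_root | k <- iota 1 n.+2].

Lemma circle_is_cycle : is_cycle (split_root :: circle_tail).
Proof.
pose f k : split_torus := shift k%:R%R split_root.
have f0 : split_root = f 0 by rewrite /f /= mulr0n addr0.
have fS k : f k.+1 = shift 1%R (f k) by rewrite /f /= !add0r natr1.
have f_size : f n.+3 = f 0.
  by congr (shift _ _); apply: val_inj; rewrite !Zp_nat /= modnn.
split; last by rewrite /= size_map size_iota.
apply/andP; split.
  have tail_eq : rcons circle_tail split_root = map f (iota 1 n.+3).
    by have := iotaD 1 n.+2 1; rewrite addn1 => ->; rewrite map_cat cats1 f_size f0.
  rewrite /path.cycle tail_eq f0 path_map; elim: n.+3 0 => //= k IHk j.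
  by rewrite IHk andbT /split_adj /along fS eqxx.
have -> : split_root :: circle_tail = map f (iota 0 n.+3) by rewrite {1}f0.
rewrite map_inj_in_uniq ?iota_uniq // => i j.
rewrite !mem_iota /= !add0n => lt_i lt_j /eqP.
by rewrite shift_eq !Zp_nat => /eqP/(congr1 val); rewrite /= !modn_small.
Qed.

End SplitTorus.

Lemma aut_cycle (G : sgraph) (s : {perm G}) (c : seq G) :
  s \in autg G -> is_cycle c -> is_cycle (map s c).
Proof.
rewrite inE => /forallP s_adj [/andP[c_path c_uniq] c_size].
split; last by rewrite size_map.
rewrite /ucycle (map_inj_uniq perm_inj) c_uniq andbT cycle_map.
by apply: sub_cycle c_path => x y /=; rewrite (eqP (forallP (s_adj x) y)).
Qed.

(** * The flexible graph *)

Section Flexible.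

Variable n : nat.

Local Notation Z := (ordinal n.+3).

Definition flexible_graph := component (split_root n).

Local Notation root := (component_root (split_root n)).

Lemma root_aut (y : flexible_graph) :
  exists2 s, s \in autg flexible_graph & s root = y.
Proof.
have [c [eps [t [h sym_root]]]] := symmetry_transitive (val y).
have root_y : connect (@adj (split_torus n)) (split_root n)
    (symmetry c eps t h (split_root n)) by rewrite sym_root (valP y).
have [s s_aut s_val] := component_aut (@symmetry_inj _ c eps t h)
  (@symmetry_adj _ c eps t h) root_y.
by exists s => //; apply: val_inj; rewrite s_val.
Qed.

Lemma flexible_graph_transitive : vertex_transitive flexible_graph.
Proof.
apply/imsetP; exists root => //; apply/setP => y; rewrite inE; apply/esym/orbitP.
by have [s s_aut <-] := root_aut y; exists s.
Qed.

Definition neighbour (v : split_torus n) (rv : adj (split_root n) v) :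
  flexible_graph := Sub v (connect1 rv).

Definition right_neighbour := neighbour (@shift_adj n (split_root n) 1%R isT).
Definition cross_neighbour := neighbour (cross_adj (split_root n)).

(** Reflecting coordinates at the root fixes the root, since the translation [h]
    can be chosen to cancel the relabelling of the trivial voltage. *)
Lemma reflection (eps : bool -> bool) :
  exists s : {perm flexible_graph},
    [/\ s \in autg flexible_graph, s root = root &
     forall y : flexible_graph,
       (val (s y)).1.1.2 = ((-1) ^+ eps (~~ (val y).1.2) * (val y).1.1.2)%R
       /\ (val (s y)).1.2 = (val y).1.2].
Proof.
pose t (_ : bool) : Z := 0%R.
pose h := (relabel n.+2 (@label_map_inj n false eps t))^-1%g.
have fix_root : symmetry false eps t h (split_root n) = split_root n.
  by rewrite /symmetry /dihedral /= !mulr0 !addr0 mulg1 mulVg.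
have root_in : connect (@adj (split_torus n)) (split_root n)
  (symmetry false eps t h (split_root n)) by rewrite fix_root.
have [s s_aut s_val] := component_aut (@symmetry_inj _ false eps t h)
  (@symmetry_adj _ false eps t h) root_in.
exists s; split=> // [|y]; first by apply: val_inj; rewrite s_val.
by rewrite s_val; case: (val y) => [[[a b] i] x]; rewrite /= /dihedral addr0.
Qed.

(** The four reflections are distinct: a reflection of the second coordinate is
    seen on the neighbour of the root in its own circle, and a reflection of the
    first coordinate on the circle at the other end of the matching edge. *)
Lemma root_stabiliser : 4 <= #|('C_(autg flexible_graph)[root | 'P])%g|.
Proof.
pose eps (e : bool * bool) s := if s then e.2 else e.1.
have /fin_all_exists[f f_prop] e := reflection (eps e).
have f_inj : injective f.
  move=> [e1 e2] [e1' e2'] eq_f.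
  have b_eq y := proj1 (let: And3 _ _ p := f_prop (e1, e2) in p y).
  have b_eq' y := proj1 (let: And3 _ _ p := f_prop (e1', e2') in p y).
  have sign_inj : injective (fun e : bool => (-1) ^+ e : Z)%R.
    case=> [] [] // /eqP; rewrite expr0 expr1; last by rewrite (negPf (one_neqN1 n)).
    by rewrite eq_sym (negPf (one_neqN1 n)).
  have far_in : connect (@adj (split_torus n)) (split_root n)
      (shift 1%R (cross (split_root n))).
    by apply: connect_trans (connect1 (cross_adj _)) (connect1 (@shift_adj n _ 1%R isT)).
  have := b_eq right_neighbour; rewrite eq_f b_eq' /= !add0r !mulr1 => /sign_inj ->.
  have := b_eq (Sub _ far_in); rewrite eq_f b_eq' /= !add0r !mulr1.
  by move/sign_inj ->.
have <- : #|f @: setT| = 4 by rewrite card_imset // cardsT card_prod card_bool.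
apply: subset_leq_card.
apply/subsetP => _ /imsetP[e _ ->]; have [f_aut f_root _] := f_prop e.
by rewrite inE f_aut; apply/astab1P.
Qed.

Lemma flexible_graph_stabiliser (x : flexible_graph) :
  4 <= #|('C_(autg flexible_graph)[x | 'P])%g|.
Proof.
have trans := atransP flexible_graph_transitive.
have := card_orbit_stab 'P (autg_group flexible_graph) x.
rewrite -(card_orbit_stab 'P (autg_group flexible_graph) root).
rewrite !trans ?inE // => /eqP; rewrite eqn_pmul2l; last first.
  by apply/card_gt0P; exists x.
by move/eqP ->; apply: root_stabiliser.
Qed.

Lemma set2_act (T : finType) (x y : T) (s : {perm T}) :
  ('P^*)%act [set x; y] s = [set s x; s y].
Proof. by rewrite /= /setact imsetU1 imset_set1. Qed.

(** An automorphism taking a circle edge to a matching edge would take a circle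
    to a cycle with a crossing but with only [n.+3] edges. *)
Lemma edge_orbits_not_merged s : s \in autg flexible_graph ->
  [set s root; s right_neighbour] != [set root; cross_neighbour].
Proof.
move=> s_aut; apply/eqP => eq_edge.
have [q q_cyc q_val] := component_cycle_lift (circle_is_cycle n).
have q_size : size q = n.+2 by rewrite -(size_map val) q_val size_map size_iota.
have /component_cycle := aut_cycle s_aut q_cyc.
case: q q_val q_size {q_cyc} => [|y q] // [y_val _] [q_size] /=.
have -> : y = right_neighbour by apply: val_inj.
have s_neq : s right_neighbour != s root.
  rewrite (inj_eq perm_inj); apply/eqP.
  by move/(congr1 (fun v => (val v).1.1.2)) => /=; rewrite add0r => /eqP;
    rewrite (negPf (one_neq0 n)).
have -> : val (s right_neighbour) = cross (val (s root)).
  have : s root \in [set root; cross_neighbour] by rewrite -eq_edge set21.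
  have : s right_neighbour \in [set root; cross_neighbour].
    by rewrite -eq_edge set22.
  move: s_neq => /[swap]; case/set2P => ->; move=> /[swap]; case/set2P => ->;
    rewrite ?eqxx //= => _.
  by rewrite -[LHS]crossK.
by move/crossing_cycle_long; rewrite /= !size_map q_size ltnn.
Qed.

Lemma flexible_graph_edge_orbits : #|edge_orbits flexible_graph| = 2.
Proof.
pose A := autg_group flexible_graph.
pose e1 : {set flexible_graph} := [set root; right_neighbour].
pose e2 : {set flexible_graph} := [set root; cross_neighbour].
have -> : edge_orbits flexible_graph
          = [set orbit ('P^*)%act A e1; orbit ('P^*)%act A e2].
  have edgeP v : adj root v -> [set root; v] \in edges flexible_graph.
    by move=> rv; apply/imsetP; exists (root, v); rewrite ?inE.
  apply/setP => O; apply/imsetP/set2P => [[_ /imsetP[[u v] uv ->] ->]|].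
    rewrite inE /= in uv.
    have [s s_aut s_root] := root_aut u.
    pose w := (s^-1)%g v.
    have s_w : s w = v by rewrite permKV.
    have rw : adj root w.
      move: s_aut; rewrite inE => /forallP/(_ root)/forallP/(_ w)/eqP <-.
      by rewrite s_root s_w.
    have -> : orbit ('P^*)%act A [set u; v] = orbit ('P^*)%act A [set root; w].
      apply/orbit_eqP/orbitP; exists s => //.
      by rewrite set2_act s_root s_w.
    case/orP: (rw) => [/orP[] | ] /eqP w_val.
    - by left; congr (orbit _ _ [set _; _]); apply: val_inj.
    (* The backward edge is the reflection of the forward one.  The reflection
       fixes the root and negates, so the image is the backward neighbour. *)
    - left; apply/orbit_eqP/orbitP.
      have [r [r_aut r_root r_val]] := reflection (fun=> true).
      exists r; rewrite // set2_act r_root; congr [set _; _].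
      have r_adj : split_adj (split_root n) (val (r right_neighbour)).
        change (adj root (r right_neighbour)); rewrite -[X in adj X _]r_root.
        move: r_aut; rewrite inE => /forallP/(_ root)/forallP/(_ right_neighbour).
        by move/eqP ->; apply: shift_adj.
      have [r_move r_side] := r_val right_neighbour.
      case/orP: r_adj => [/orP[] | ] /eqP r_eq.
      + move: r_move; rewrite r_eq /= !add0r mulr1 expr1 => /eqP.
        by rewrite (negPf (one_neqN1 n)).
      + by apply: val_inj; rewrite r_eq.
      + by move: r_side; rewrite r_eq.
    - by right; congr (orbit _ _ [set _; _]); apply: val_inj.
  case=> ->; [exists e1 | exists e2] => //; apply: edgeP.
    exact: shift_adj.
  exact: cross_adj.
rewrite cards2 eq_sym; case: eqVneq => // /orbit_eqP/orbitP[s s_aut].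
by rewrite set2_act => /eqP; rewrite (negPf (edge_orbits_not_merged s_aut)).
Qed.

Lemma flexible_graph_girth : has_girth flexible_graph n.+3.
Proof.
split=> [|c /component_cycle/split_torus_girth]; last by rewrite size_map.
have [q q_cyc q_val] := component_cycle_lift (circle_is_cycle n).
exists (root :: q) => //.
by rewrite /= -(size_map val) q_val size_map size_iota.
Qed.

End Flexible.

Theorem theorem1 (l : nat) (hl : 2 <= l) :
  exists G : sgraph,
    [/\ connected G, vertex_transitive G, trivalent G, flexible G
      & has_girth G (2 * l)].
Proof.
have -> : 2 * l = (2 * l - 3).+3.
  by rewrite -addn3 subnK // (leq_trans _ (leq_mul (leqnn 2) hl)).
set n := 2 * l - 3.
have conn := component_connected (split_root n).
have trans := flexible_graph_transitive n.
have triv := component_trivalent (x0 := split_root n) (@split_torus_trivalent n).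
exists (flexible_graph n); split=> //; last exact: flexible_graph_girth.
split=> //; first exact: flexible_graph_edge_orbits.
exact: flexible_graph_stabiliser.
Qed.
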